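(* Let $U_7^4=\{L(C)\in TLeib_7 : c_{2,3}\neq 0,\ c_{1,1}=c_{0,1}=0,\ c_{1,2}\neq 0,\ c_{0,0}=0\}$. 1. Two algebras $L(C)$ and $L(C')$ from $U_7^4$ are isomorphic if and only if $\frac{c'_{1,2}}{c'_{2,3}}=\frac{c_{1,2}}{c_{2,3}}$. 2. For any $\lambda\in\mathbb{C}^*=\mathbb{C}\setminus\{0\}$ there exists $L(C)\in U_7^4$ with $\frac{c_{1,2}}{c_{2,3}}=\lambda$. Moreover, the orbits (isomorphism classes) in $U_7^4$ are parameterized by the algebras $L(0,0,0,\lambda,0,0,1)$, $\lambda\in\mathbb{C}^*$: these algebras lie in $U_7^4$ and every algebra in $U_7^4$ is isomorphic to one of them.
   Context: All algebras are over $\mathbb{C}$. For $C=(c_{0,0},c_{0,1},c_{1,1},c_{1,2},c_{1,3},c_{1,4},c_{2,3})\in\mathbb{C}^7$, $L(C)$ denotes the $7$-dimensional complex (Leibniz) algebra with basis $e_0,e_1,\dots,e_6$ and products (products of basis vectors not listed are zero): $[e_i,e_0]=e_{i+1}$ for $1\le i\le 5$; $[e_0,e_i]=-e_{i+1}$ for $2\le i\le 5$; $[e_0,e_0]=c_{0,0}e_6$; $[e_0,e_1]=-e_2+c_{0,1}e_6$; $[e_1,e_1]=c_{1,1}e_6$; $[e_1,e_2]=-[e_2,e_1]=c_{1,2}e_4+c_{1,3}e_5+c_{1,4}e_6$; $[e_1,e_3]=-[e_3,e_1]=c_{1,2}e_5+c_{1,3}e_6$; $[e_1,e_4]=-[e_4,e_1]=(c_{1,2}-c_{2,3})e_6$;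 $[e_2,e_3]=-[e_3,e_2]=c_{2,3}e_6$. $TLeib_7$ is the set of all $L(C)$, $C\in\mathbb{C}^7$. The entries of $C'$ are denoted $c'_{i,j}$, in the same order. ''Isomorphic'' means isomorphic as algebras over $\mathbb{C}$; an orbit is an isomorphism class. *)

(* Defs.v *)
From HB Require Import structures.
From mathcomp Require Import all_boot all_order all_algebra.
From mathcomp Require Import classical_sets reals.
From mathcomp Require Export complex.

Set Implicit Arguments.
Unset Strict Implicit.
Unset Printing Implicit Defensive.

Import GRing.Theory.

Local Open Scope ring_scope.
Local Open Scope classical_set_scope.

(* An algebra over K, not necessarily associative, is a K-vector space together
   with a bilinear product. *)
Definition alg_isom (K : fieldType) (U V : lmodType K)
    (m : {bilinear U -> U -> U}) (m' : {bilinear V -> V -> V}) : Prop :=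
  exists f : {linear U -> V}, bijective f /\ forall x y, f (m x y) = m' (f x) (f y).

Record coefs (K : fieldType) := Coefs {
  c00 : K; c01 : K; c11 : K; c12 : K; c13 : K; c14 : K; c23 : K }.

Section TLeib7.
Variable K : fieldType.
Implicit Types C : coefs K.

(* Only used for i <= 6: inord would send larger i to 0. *)
Definition e (i : nat) : 'rV[K]_7 := delta_mx 0 (inord i).

(* The product [e_i, e_j] in L(C). *)
Definition bracket C (i j : nat) : 'rV[K]_7 :=
  match i, j with
  | 0, 0 => c00 C *: e 6
  | 0, 1 => - e 2 + c01 C *: e 6
  | 0, (2 | 3 | 4 | 5) => - e j.+1
  | (1 | 2 | 3 | 4 | 5), 0 => e i.+1
  | 1, 1 => c11 C *: e 6
  | 1, 2 => c12 C *: e 4 + c13 C *: e 5 + c14 C *: e 6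
  | 2, 1 => - (c12 C *: e 4 + c13 C *: e 5 + c14 C *: e 6)
  | 1, 3 => c12 C *: e 5 + c13 C *: e 6
  | 3, 1 => - (c12 C *: e 5 + c13 C *: e 6)
  | 1, 4 => (c12 C - c23 C) *: e 6
  | 4, 1 => - ((c12 C - c23 C) *: e 6)
  | 2, 3 => c23 C *: e 6
  | 3, 2 => - (c23 C *: e 6)
  | _, _ => 0
  end.

Definition Lmul C (x y : 'rV[K]_7) : 'rV[K]_7 :=
  \sum_(i < 7) \sum_(j < 7) (x 0 i * y 0 j) *: bracket C i j.

Lemma Lmul_bilinear C : bilinear_for *:%R *:%R (Lmul C).
Proof.
split=> [y|x] a u v /=; rewrite /Lmul scaler_sumr -big_split /=;
  apply: eq_bigr => i _; rewrite scaler_sumr -big_split /=;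
  apply: eq_bigr => j _; rewrite !mxE scalerA -scalerDl.
- by rewrite mulrDl mulrA.
- by rewrite mulrDr mulrCA.
Qed.

HB.instance Definition _ C :=
  bilinear_isBilinear.Build K 'rV[K]_7 'rV[K]_7 'rV[K]_7 *:%R *:%R
    (Lmul C) (Lmul_bilinear C).

Definition L C : {bilinear 'rV[K]_7 -> 'rV[K]_7 -> 'rV[K]_7} := Lmul C.

(* A subset of TLeib_7, which is the range of L. *)
Definition U74 : set {bilinear 'rV[K]_7 -> 'rV[K]_7 -> 'rV[K]_7} :=
  [set L C | C in [set C | [/\ c23 C != 0, c11 C = 0 /\ c01 C = 0,
                               c12 C != 0 & c00 C = 0]]].

End TLeib7.

(* Main.v *)
From HB Require Import structures.
Require Import Defs.
From mathcomp Require Import all_boot all_order all_algebra.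
From mathcomp Require Import classical_sets reals.
From mathcomp Require Import ring.
Local Open Scope ring_scope.

Set Implicit Arguments.
Unset Strict Implicit.
Unset Printing Implicit Defensive.

Import GRing.Theory Num.Theory.

(** Write a = c12 C, c = c13 C, d = c14 C, b = c23 C.

    The ratio a / b is an invariant: an isomorphism is determined by the images
    x = A e0 + B e1 + ... and y = P e0 + Q e1 + ... of e0 and e1, because
    e_{i+1} = [e_i, e0] for i >= 1. Products move later in the basis, so only
    leading coefficients matter: with D = QA - PB, the image of e_i (i >= 2) is
    D A^(i-2) e_i plus later basis vectors, so D and A do not vanish. The
    relation [e1, e5] = 0 forces P = 0, and comparing leading coefficients in
    [e1, e2] and in [e2, e3] gives a A^2 = a' Q and b A^2 = b' Q. Hence a and b
    are rescaled by one common nonzero factor. This is [isom_ratio].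

    Conversely, suppose that c00, c01, c11 vanish and a, b do not. Replacing e0
    by e0 + B e1 and e1 by e1 + q e3, and recomputing e_{i+1} as [e_i, e0],
    adds 2 a^2 B to c, and to d it adds - 2 b q and a term that does not involve
    q; so a suitable B and then a suitable q bring both to 0. Multiplying
    e1, ..., e6 by 1/b then turns (a, b) into (a/b, 1). This is
    [isom_normal_form]. Two algebras with the same ratio are thus isomorphic
    through their common normal form. *)

(** * Isomorphism is an equivalence relation *)

Lemma alg_isom_sym (K : fieldType) (U V : lmodType K)
    (m : {bilinear U -> U -> U}) (m' : {bilinear V -> V -> V}) :
  alg_isom m m' -> alg_isom m' m.
Proof.
case=> f [[g fK gK] fM].
pose g_lin := GRing.isLinear.Build K V U _ g (can2_linear fK gK).
pose gL : {linear V -> U} := HB.pack g g_lin.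
exists gL; split; first by exists f.
by move=> x y; apply: (can_inj fK); rewrite fM /= !gK.
Qed.

Lemma alg_isom_trans (K : fieldType) (U V W : lmodType K)
    (m : {bilinear U -> U -> U}) (m' : {bilinear V -> V -> V})
    (m'' : {bilinear W -> W -> W}) :
  alg_isom m m' -> alg_isom m' m'' -> alg_isom m m''.
Proof.
case=> f [fB fM] [g [gB gM]].
exists (g \o f : {linear U -> W}); split; first exact: bij_comp.
by move=> x y; rewrite /= fM gM.
Qed.

(** * Products in coordinates *)

Section Coordinates.
Variable K : fieldType.

(** Seven-term lists let the arithmetic of row vectors reduce to scalar
    identities that [ring] and [field] can decide. *)
Definition vec (s : seq K) : 'rV[K]_7 := \row_k s`_k.

Lemma vec_inj (s t : seq K) i : (i < 7)%N -> vec s = vec t -> s`_i = t`_i.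
Proof. by move=> lti /rowP/(_ (Ordinal lti)); rewrite !mxE. Qed.

Lemma eq_vec (x0 x1 x2 x3 x4 x5 x6 y0 y1 y2 y3 y4 y5 y6 : K) :
  x0 = y0 -> x1 = y1 -> x2 = y2 -> x3 = y3 -> x4 = y4 -> x5 = y5 -> x6 = y6 ->
  vec [:: x0; x1; x2; x3; x4; x5; x6] = vec [:: y0; y1; y2; y3; y4; y5; y6].
Proof. by move=> -> -> -> -> -> -> ->. Qed.

Lemma vecD (x0 x1 x2 x3 x4 x5 x6 y0 y1 y2 y3 y4 y5 y6 : K) :
  vec [:: x0; x1; x2; x3; x4; x5; x6] + vec [:: y0; y1; y2; y3; y4; y5; y6] =
  vec [:: x0 + y0; x1 + y1; x2 + y2; x3 + y3; x4 + y4; x5 + y5; x6 + y6].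
Proof. by apply/rowP; case; do 7?[case=> [|]] => // lt7; rewrite !mxE. Qed.

Lemma vecN (x0 x1 x2 x3 x4 x5 x6 : K) :
  - vec [:: x0; x1; x2; x3; x4; x5; x6] =
  vec [:: - x0; - x1; - x2; - x3; - x4; - x5; - x6].
Proof. by apply/rowP; case; do 7?[case=> [|]] => // lt7; rewrite !mxE. Qed.

Lemma vecZ (a x0 x1 x2 x3 x4 x5 x6 : K) :
  a *: vec [:: x0; x1; x2; x3; x4; x5; x6] =
  vec [:: a * x0; a * x1; a * x2; a * x3; a * x4; a * x5; a * x6].
Proof. by apply/rowP; case; do 7?[case=> [|]] => // lt7; rewrite !mxE. Qed.

Lemma vecP (v : 'rV[K]_7) :
  exists x0 x1 x2 x3 x4 x5 x6, v = vec [:: x0; x1; x2; x3; x4; x5; x6].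
Proof.
exists (v 0 (inord 0)), (v 0 (inord 1)), (v 0 (inord 2)), (v 0 (inord 3)).
exists (v 0 (inord 4)), (v 0 (inord 5)), (v 0 (inord 6)).
apply/rowP; case; do 7?[case=> [|]]; last by [].
all: by move=> lt7; rewrite mxE /=; congr (v _ _); apply: val_inj; rewrite /= inordK.
Qed.

Lemma e_vec i : (i < 7)%N -> e K i = vec (mkseq (fun k => if k == i then 1 else 0) 7).
Proof.
move=> lti; apply/rowP=> j; rewrite !mxE eqxx /= (nth_mkseq _ _ (ltn_ord j)).
by rewrite -val_eqE /= inordK //; case: eqP.
Qed.

Lemma L_e (C : coefs K) i j :
  (i < 7)%N -> (j < 7)%N -> L C (e K i) (e K j) = bracket C i j.
Proof.
move=> lti ltj; change (Lmul C (e K i) (e K j) = bracket C i j).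
rewrite /Lmul (bigD1 (inord i)) //= [X in _ + X]big1 => [|k kNi]; last first.
  by rewrite big1 // => l _; rewrite !mxE (negbTE kNi) andbF mul0r scale0r.
rewrite (bigD1 (inord j)) //= [X in _ + X + _]big1 => [|l lNj]; last first.
  by rewrite !mxE (negbTE lNj) andbF mulr0 scale0r.
by rewrite !mxE !eqxx mulr1 scale1r !addr0 !inordK.
Qed.

Lemma L_vec (C : coefs K)
    (x0 x1 x2 x3 x4 x5 x6 y0 y1 y2 y3 y4 y5 y6 : K) :
  L C (vec [:: x0; x1; x2; x3; x4; x5; x6])
      (vec [:: y0; y1; y2; y3; y4; y5; y6]) =
  vec [:: 0; 0; x1 * y0 - x0 * y1; x2 * y0 - x0 * y2;
    x3 * y0 - x0 * y3 + c12 C * (x1 * y2 - x2 * y1);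
    x4 * y0 - x0 * y4 + c13 C * (x1 * y2 - x2 * y1) + c12 C * (x1 * y3 - x3 * y1);
    x5 * y0 - x0 * y5 + c14 C * (x1 * y2 - x2 * y1) + c13 C * (x1 * y3 - x3 * y1)
    + (c12 C - c23 C) * (x1 * y4 - x4 * y1) + c23 C * (x2 * y3 - x3 * y2)
    + c00 C * (x0 * y0) + c01 C * (x0 * y1) + c11 C * (x1 * y1)].
Proof.
rewrite -[LHS]/(Lmul C _ _) /Lmul !big_ord_recl !big_ord0 /=.
rewrite !(scaler0, addr0, add0r) !e_vec //= !mxE /mkseq /=.
rewrite !(vecN, vecZ, vecD).
by apply: eq_vec; ring.
Qed.

(** Membership of L C in the family only says that L C equals L D for some D
    with the required coefficients; injectivity transfers the requirements to
    C. *)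
Lemma L_inj : injective (@L K).
Proof.
move=> C D eqL.
have br i j : (i < 7)%N -> (j < 7)%N ->
    L C (e K i) (e K j) = L D (e K i) (e K j) by move=> *; rewrite eqL.
have := br 0%N 0%N isT isT; have := br 0%N 1%N isT isT.
have := br 1%N 1%N isT isT; have := br 1%N 2%N isT isT.
have := br 2%N 3%N isT isT.
rewrite !e_vec // !L_vec.
move=> /(@vec_inj _ _ 6 isT) /= E23.
move=> E12; have E4 := @vec_inj _ _ 4 isT E12; have E5 := @vec_inj _ _ 5 isT E12.
move: E12 => /(@vec_inj _ _ 6 isT) /= E6.
move=> /(@vec_inj _ _ 6 isT) /= E11.
move=> /(@vec_inj _ _ 6 isT) /= E01.
move=> /(@vec_inj _ _ 6 isT) /= E00.
move: E23 E4 E5 E6 E11 E01 E00; rewrite /= {br eqL}.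
rewrite !(mul0r, mulr0, mul1r, mulr1, subr0, sub0r, addr0, add0r, oppr0).
by case: C; case: D => /= *; congr Coefs.
Qed.

Lemma U74_L (C : coefs K) :
  U74 (L C) ->
  [/\ c23 C != 0, c11 C = 0 /\ c01 C = 0, c12 C != 0 & c00 C = 0].
Proof. by case=> D UD /L_inj <-. Qed.

(** * Invariance of the ratio *)

(** An isomorphism respects the filtration by the spans of e_k, ..., e_6, and
    its effect on leading coefficients rescales c12 and c23 by the same
    factor. *)
Lemma isom_ratio (C C' : coefs K) :
  alg_isom (L C) (L C') -> c12 C' / c23 C' = c12 C / c23 C.
Proof.
case=> f [/bij_inj f_inj fM].
have [A [B [x2 [x3 [x4 [x5 [x6 Ex]]]]]]] := vecP (f (e K 0)).
have [P [Q [y2 [y3 [y4 [y5 [y6 Ey]]]]]]] := vecP (f (e K 1)).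
have fe i j : (i < 7)%N -> (j < 7)%N ->
    f (bracket C i j) = L C' (f (e K i)) (f (e K j)).
  by move=> lti ltj; rewrite -L_e // fM.
pose D := Q * A - P * B.
have [s2 [t2 [u2 [v2 E2]]]] : exists s t u v, f (e K 2) = vec [:: 0; 0; D; s; t; u; v].
  rewrite (fe 1%N 0%N) // Ex Ey L_vec.
  by do 4 eexists; apply: eq_vec; first [reflexivity | rewrite /D; ring].
have [t3 [u3 [v3 E3]]] : exists t u v, f (e K 3) = vec [:: 0; 0; 0; D * A; t; u; v].
  rewrite (fe 2%N 0%N) // E2 Ex L_vec.
  by do 3 eexists; apply: eq_vec; first [reflexivity | ring].
have [u4 [v4 E4]] : exists u v, f (e K 4) = vec [:: 0; 0; 0; 0; D * A ^+ 2; u; v].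
  rewrite (fe 3%N 0%N) // E3 Ex L_vec.
  by do 2 eexists; apply: eq_vec; first [reflexivity | ring].
have [v5 E5] : exists v, f (e K 5) = vec [:: 0; 0; 0; 0; 0; D * A ^+ 3; v].
  rewrite (fe 4%N 0%N) // E4 Ex L_vec.
  by eexists; apply: eq_vec; first [reflexivity | ring].
have E6 : f (e K 6) = vec [:: 0; 0; 0; 0; 0; 0; D * A ^+ 4].
  by rewrite (fe 5%N 0%N) // E5 Ex L_vec; apply: eq_vec; ring.
(* Injectivity of f at e6 makes all the leading coefficients nonzero. *)
have DA4 : D * A ^+ 4 != 0.
  apply/eqP=> DA0; have : f (e K 6) = f 0.
    rewrite E6 DA0 linear0; apply/rowP=> k; rewrite !mxE.
    by case: k; do 7?[case=> [|]].
  move=> /f_inj /rowP /(_ (inord 6)) /eqP.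
  by rewrite !mxE !eqxx oner_eq0.
have [D0 A0] : D != 0 /\ A != 0.
  by apply/andP; move: DA4; rewrite mulf_eq0 expf_eq0 /= negb_or.
(* [e1, e5] = 0, but an e0-component in the image of e1 would act nontrivially
   on the image of e5. *)
have P0 : P = 0.
  have := fe 1%N 5%N isT isT; rewrite [bracket _ _ _]/= linear0 Ey E5 L_vec.
  have -> : 0 = vec [:: 0; 0; 0; 0; 0; 0; 0].
    by apply/rowP=> k; rewrite !mxE; case: k; do 7?[case=> [|]].
  move=> /(@vec_inj _ _ 6 isT) /= PDA.
  have /eqP : P * (D * A ^+ 3) = 0 by rewrite -[RHS]oppr0 PDA; ring.
  have DA3 : D * A ^+ 3 != 0 by rewrite mulf_neq0 ?expf_neq0.
  by rewrite mulf_eq0 (negbTE DA3) orbF => /eqP.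
have DE : D = Q * A by rewrite /D P0 mul0r subr0.
have Q0 : Q != 0 by move: D0; rewrite DE mulf_eq0 negb_or => /andP[].
have a_rel : c12 C * A ^+ 2 = c12 C' * Q.
  have := fe 1%N 2%N isT isT; rewrite [bracket _ _ _]/= !linearD !linearZ /=.
  rewrite Ey E2 E4 E5 E6 L_vec P0 => /rowP/(_ (inord 4)).
  rewrite !mxE inordK //= => aE; apply: (mulIf D0).
  transitivity (c12 C * (D * A ^+ 2)); first by ring.
  by move: aE; rewrite !(mulr0, addr0, mul0r, subr0, add0r) => ->; ring.
have b_rel : c23 C * A ^+ 2 = c23 C' * Q.
  have := fe 2%N 3%N isT isT; rewrite [bracket _ _ _]/= linearZ /=.
  rewrite E2 E3 E6 L_vec => /rowP/(_ (inord 6)).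
  rewrite !mxE inordK //= => bE.
  have DA2 : D * A ^+ 2 != 0 by rewrite mulf_neq0 ?expf_neq0.
  apply: (mulIf DA2); transitivity (c23 C * (D * A ^+ 4)); first by ring.
  by rewrite bE DE; ring.
have Q_A2 : Q / A ^+ 2 != 0 by rewrite mulf_neq0 ?invr_eq0 ?expf_neq0.
have A2_0 : A ^+ 2 != 0 by rewrite expf_neq0.
have -> : c12 C = c12 C' * (Q / A ^+ 2) by rewrite mulrA -a_rel mulfK.
have -> : c23 C = c23 C' * (Q / A ^+ 2) by rewrite mulrA -b_rel mulfK.
by rewrite -mulf_div divff // mulr1.
Qed.

(** * Normal form *)

(** The rows are x = e0 + B e1 and Q z_1, ..., Q z_6, where z_1 = e1 + q e3 and
    z_{i+1} = [z_i, x] in the algebra with coefficients (0,0,0,a,c,d,b). The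
    values of c and d are those for which [z_1, z_2] = a z_4 exactly; the
    remaining relations then hold as well. *)
Definition normal_basis (a b B q Q : K) : 'M[K]_7 :=
  let c := - (2%:R * a ^+ 2 * B) in
  let d := 2%:R * b * q + a ^+ 2 * B ^+ 2 * (5%:R * a - b) in
  \matrix_(i < 7) nth 0 [::
    vec [:: 1; B; 0; 0; 0; 0; 0];
    Q *: vec [:: 0; 1; 0; q; 0; 0; 0];
    Q *: vec [:: 0; 0; 1; 0; q; - (a * B * q); - (c * B * q)];
    Q *: vec [:: 0; 0; 0; 1; - (a * B); q - c * B; - (d * B) - (2%:R * a - b) * B * q];
    Q *: vec [:: 0; 0; 0; 0; 1; - (2%:R * a * B);
                 q - 2%:R * c * B + a * (a - b) * B ^+ 2];
    Q *: vec [:: 0; 0; 0; 0; 0; 1; - ((3%:R * a - b) * B)];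
    Q *: vec [:: 0; 0; 0; 0; 0; 0; 1]] i.

Lemma normal_basis_unit (a b B q Q : K) : Q != 0 -> normal_basis a b B q Q \in unitmx.
Proof.
move=> Q0; rewrite unitmxE -det_tr det_trig; last first.
  by apply/is_trig_mxP; case; do 7?[case=> [|]] => // lti;
     case; do 7?[case=> [|]] => // ltj //= _; rewrite !mxE /= ?mxE /= ?mulr0.
rewrite !big_ord_recl big_ord0 !mxE /= ?mxE /= ?mulr1 unitfE.
by rewrite !mulf_neq0 ?oner_neq0.
Qed.

(** Every product of two of z_1, ..., z_6 scales by Q^2 while its expansion
    scales by Q, so the structure constants a and b become Q a and Q b = 1. *)
Lemma normal_basis_isom (a b B q Q : K) : Q * b = 1 ->
  alg_isom (L (Coefs 0 0 0 (Q * a) 0 0 1))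
    (L (Coefs 0 0 0 a (- (2%:R * a ^+ 2 * B))
          (2%:R * b * q + a ^+ 2 * B ^+ 2 * (5%:R * a - b)) b)).
Proof.
move=> Qb; have b0 : b != 0.
  by apply: contra_eq_neq Qb => ->; rewrite mulr0 eq_sym oner_eq0.
have {Qb} -> : Q = b^-1 by apply: (mulIf b0); rewrite Qb mulVf.
pose M := normal_basis a b B q b^-1.
have Mu : M \in unitmx by rewrite normal_basis_unit // invr_eq0.
exists (mulmxr M : {linear 'rV[K]_7 -> 'rV[K]_7}); split=> [|x y] /=.
  by exists (mulmxr (invmx M)) => v /=; rewrite ?mulmxK ?mulmxKV.
have [x0 [x1 [x2 [x3 [x4 [x5 [x6 ->]]]]]]] := vecP x.
have [y0 [y1 [y2 [y3 [y4 [y5 [y6 ->]]]]]]] := vecP y.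
rewrite L_vec !mulmx_sum_row !big_ord_recl !big_ord0 !addr0 !rowK !mxE /=.
rewrite !(vecZ, vecD) L_vec /=.
by apply: eq_vec; field.
Qed.

(** In [normal_basis_isom], c13 is linear in B with slope - 2 a^2, and for a
    fixed B, c14 is affine in q with slope 2 b. Hence B and then q can be chosen
    to match any given c13 and c14. *)
Lemma isom_normal_form (C : coefs K) :
    (2%:R : K) != 0 -> c00 C = 0 -> c01 C = 0 -> c11 C = 0 ->
    c12 C != 0 -> c23 C != 0 ->
  alg_isom (L (Coefs 0 0 0 (c12 C / c23 C) 0 0 1)) (L C).
Proof.
case: C => c00 c01 c11 a c d b /= two0 -> -> -> a0 b0.
pose B := - (c / (2%:R * a ^+ 2)).
pose q := (d - a ^+ 2 * B ^+ 2 * (5%:R * a - b)) / (2%:R * b).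
have cE : - (2%:R * a ^+ 2 * B) = c by rewrite /B; field; apply/andP.
have dE : 2%:R * b * q + a ^+ 2 * B ^+ 2 * (5%:R * a - b) = d.
  by rewrite /q; field; apply/andP.
have := normal_basis_isom a B q (mulVf b0).
by rewrite cE dE [b^-1 * a]mulrC.
Qed.

End Coordinates.

Theorem proposition2p4 (R : realType) :
  (forall C C' : coefs R[i], U74 (L C) -> U74 (L C') ->
     (alg_isom (L C) (L C') <-> c12 C' / c23 C' = c12 C / c23 C)) /\
  (forall lam : R[i], lam != 0 ->
     exists C : coefs R[i], U74 (L C) /\ c12 C / c23 C = lam) /\
  (forall lam : R[i], lam != 0 -> U74 (L (Coefs 0 0 0 lam 0 0 1))) /\
  (forall A : {bilinear 'rV[R[i]]_7 -> 'rV[R[i]]_7 -> 'rV[R[i]]_7},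
     U74 A ->
     exists lam : R[i], lam != 0 /\ alg_isom A (L (Coefs 0 0 0 lam 0 0 1))).
Proof.
have two0 : (2%:R : R[i]) != 0 by rewrite pnatr_eq0.
have U74_normal (lam : R[i]) : lam != 0 -> U74 (L (Coefs 0 0 0 lam 0 0 1)).
  by move=> lam0; exists (Coefs 0 0 0 lam 0 0 1) => //; split; rewrite ?oner_neq0.
split=> [C C' /U74_L [b0 [C11 C01] a0 C00] /U74_L [b0' [C11' C01'] a0' C00']|].
  split=> [|ratioE]; first exact: isom_ratio.
  apply: alg_isom_trans (alg_isom_sym (isom_normal_form _ _ _ _ _ _)) _ => //.
  by rewrite -ratioE; exact: isom_normal_form.
split=> [lam lam0|].
  exists (Coefs 0 0 0 lam 0 0 1); split; first exact: U74_normal.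
  exact: divr1.
split=> [//|A [C [b0 [C11 C01] a0 C00] <-]].
exists (c12 C / c23 C); split; first by rewrite mulf_neq0 ?invr_eq0.
by apply: alg_isom_sym; exact: isom_normal_form.
Qed.
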